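(* Given a matroid $M=(S,\mathcal{I})$ (by an independence oracle), a set $S_0\subseteq S$ such that some basis of $M$ is not contained in $S_0$, and $w\in\mathbb{R}^S$, an optimal weight function for the Relaxed-IM-Not-Exists instance $(M,S_0,w,\|\cdot\|_\infty)$ can be computed in polynomial time (by a binary search over values $\pm(w(e)-w(f))/2$, $e\in S_0$, $f\in S\setminus S_0$).
   Context: Relaxed-IM-Not-Exists: find $\widehat{w}\in\mathbb{R}^S$ such that some basis of $M$ not contained in $S_0$ is a maximum $\widehat{w}$-weight basis of $M$, minimizing $\|w-\widehat{w}\|_\infty=\max_s|w(s)-\widehat{w}(s)|$. Polynomial time is measured in independence oracle calls and elementary operations. *)

(* Defs.v *)
From mathcomp Require Import all_boot all_order all_algebra.
Set Implicit Arguments.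
Unset Strict Implicit.
Unset Printing Implicit Defensive.
Import Order.TTheory GRing.Theory Num.Theory.
Local Open Scope ring_scope.

Record matroid (S : finType) := Matroid {
  indep : pred {set S};
  indep0 : indep set0;
  indep_sub : forall X Y : {set S}, X \subset Y -> indep Y -> indep X;
  indep_exchange : forall X Y : {set S}, indep X -> indep Y ->
    (#|X| < #|Y|)%N -> exists2 y, y \in Y :\: X & indep (y |: X) }.

Definition basis (S : finType) (M : matroid S) (B : {set S}) : bool :=
  maxset (indep M) B.

Section RelaxedIMNotExists.
Variables (R : realFieldType) (S : finType) (M : matroid S) (S0 : {set S}).

Definition weight (w : S -> R) (X : {set S}) : R := \sum_(s in X) w s.

Definition max_weight_basis (w : S -> R) (B : {set S}) : Prop :=
  basis M B /\ forall B', basis M B' -> weight w B' <= weight w B.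

(* The index 0 of the iterated maximum is harmless: all terms are >= 0. *)
Definition dist_infty (w w' : S -> R) : R :=
  \big[Num.max/0]_(s : S) `|w s - w' s|.

Definition feasible (w' : S -> R) : Prop :=
  exists2 B, max_weight_basis w' B & ~~ (B \subset S0).

Definition optimal (w w' : S -> R) : Prop :=
  feasible w' /\
  forall w'', feasible w'' -> dist_infty w w' <= dist_infty w w''.

End RelaxedIMNotExists.

(* Model of computation: a real RAM with an independence oracle, programmed   *)
(* in a while-language.  The memory consists of natural-number registers,     *)
(* arrays of reals and arrays of booleans.  A program is a finite syntactic   *)
(* object that mentions neither the instance nor any real constant other than *)
(* natural numbers, hence it is uniform in the instance.  Natural numbers     *)
(* only have addition and truncated subtraction, and reals cannot be          *)
(* truncated, so that unit cost is harmless.                                  *)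

(* (a, x) denotes the cell of array a whose index is the content of the       *)
(* register x.                                                                *)
Definition loc : Type := (nat * nat)%type.

Variant arith := Add | Sub | Mul | Div.

Variant instr :=
| NConst of nat & nat
| NAdd of nat & nat & nat
| NSub of nat & nat & nat
| RConst of loc & nat
| RMov of loc & loc
| ROp of arith & loc & loc & loc
| BConst of loc & bool
| BMov of loc & loc
(* Query l q stores in l whether the set whose indicator is the boolean       *)
(* array q is independent.                                                    *)
| Query of loc & nat.

Variant test :=
| NLt of nat & nat
| RLe of loc & loc
| BTest of loc.

Inductive cmd :=
| Do of instr
| Seq of cmd & cmd
| If of test & cmd & cmd
| While of test & cmd.

Record state (R : Type) := State {
  reg : nat -> nat;
  rarr : nat -> nat -> R;
  barr : nat -> nat -> bool }.

Section Semantics.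
Variables (R : realFieldType) (S : finType) (oracle : pred {set S}).
Implicit Types (st : state R) (l : loc).

Definition upd (T : Type) (f : nat -> T) (i : nat) (v : T) : nat -> T :=
  fun j => if j == i then v else f j.

Definition upd2 (T : Type) (f : nat -> nat -> T) (a i : nat) (v : T) :=
  upd f a (upd (f a) i v).

Definition set_reg st x v := State (upd (reg st) x v) (rarr st) (barr st).
Definition rget st l : R := rarr st l.1 (reg st l.2).
Definition rset st l v :=
  State (reg st) (upd2 (rarr st) l.1 (reg st l.2) v) (barr st).
Definition bget st l : bool := barr st l.1 (reg st l.2).
Definition bset st l v :=
  State (reg st) (rarr st) (upd2 (barr st) l.1 (reg st l.2) v).

(* Elements of S are represented by their rank in the enumeration of S. *)
Definition decode (b : nat -> bool) : {set S} :=
  [set s : S | b (enum_rank s)].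

Definition eval_arith (o : arith) (u v : R) : R :=
  match o with Add => u + v | Sub => u - v | Mul => u * v | Div => u / v end.

Definition eval_instr (i : instr) st : state R :=
  match i with
  | NConst x k => set_reg st x k
  | NAdd x y z => set_reg st x (reg st y + reg st z)%N
  | NSub x y z => set_reg st x (reg st y - reg st z)%N
  | RConst l k => rset st l k%:R
  | RMov l l1 => rset st l (rget st l1)
  | ROp o l l1 l2 => rset st l (eval_arith o (rget st l1) (rget st l2))
  | BConst l b => bset st l b
  | BMov l l1 => bset st l (bget st l1)
  | Query l q => bset st l (oracle (decode (barr st q)))
  end.

Definition eval_test (t : test) st : bool :=
  match t with
  | NLt x y => (reg st x < reg st y)%N
  | RLe l1 l2 => rget st l1 <= rget st l2
  | BTest l => bget st l
  end.

(* exec c st st' t: started in st, the program c halts in st' after exactly t *)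
(* elementary steps; an instruction (in particular an oracle call) and the    *)
(* evaluation of a test each count for one step.                              *)
Inductive exec : cmd -> state R -> state R -> nat -> Prop :=
| exec_do i st : exec (Do i) st (eval_instr i st) 1
| exec_seq c1 c2 st1 st2 st3 t1 t2 :
    exec c1 st1 st2 t1 -> exec c2 st2 st3 t2 ->
    exec (Seq c1 c2) st1 st3 (t1 + t2)
| exec_if b c1 c2 st st' t :
    exec (if eval_test b st then c1 else c2) st st' t ->
    exec (If b c1 c2) st st' t.+1
| exec_while_end b c st :
    ~~ eval_test b st -> exec (While b c) st st 1
| exec_while_step b c st1 st2 st3 t1 t2 :
    eval_test b st1 -> exec c st1 st2 t1 -> exec (While b c) st2 st3 t2 ->
    exec (While b c) st1 st3 (t1 + t2).+1.

Lemma exec_det c st st1 st2 t1 t2 :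
  exec c st st1 t1 -> exec c st st2 t2 -> st1 = st2 /\ t1 = t2.
Proof.
move=> e1; elim: e1 st2 t2 => {c st st1 t1}
  [i st|c1 c2 s1 s2 s3 t1 t2 _ IH1 _ IH2|b c1 c2 s s' t _ IH|b c s nb
  |b c s1 s2 s3 t1 t2 hb _ IH1 _ IH2] st2 t3 e; inversion e; subst => //.
- match goal with H : exec c1 _ _ _ |- _ => case: (IH1 _ _ H) => ? ?; subst end.
  by match goal with H : exec c2 _ _ _ |- _ => case: (IH2 _ _ H) => -> -> end.
- by match goal with H : exec (if _ then _ else _) _ _ _ |- _ =>
    case: (IH _ _ H) => -> -> end.
- by match goal with H : is_true (eval_test _ _) |- _ => rewrite H in nb end.
- by match goal with H : is_true (~~ _) |- _ => rewrite hb in H end.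
match goal with H : exec c _ _ _ |- _ => case: (IH1 _ _ H) => ? ?; subst end.
by match goal with H : exec (While _ _) _ _ _ |- _ =>
  case: (IH2 _ _ H) => -> -> end.
Qed.

(* Cells that do not hold the input have arbitrary contents. *)
Definition encodes_input (S0 : {set S}) (w : S -> R) st : Prop :=
  [/\ reg st 0 = #|S|,
      forall s : S, rarr st 0 (enum_rank s) = w s
    & forall s : S, barr st 0 (enum_rank s) = (s \in S0)].

Definition output st : S -> R := fun s => rarr st 1 (enum_rank s).

End Semantics.

(* Main.v *)
Require Import Defs.
From mathcomp Require Import all_boot all_order all_algebra.
From mathcomp Require Import reals zify lra.
Set Implicit Arguments.
Unset Strict Implicit.
Unset Printing Implicit Defensive.
Import Order.TTheory GRing.Theory Num.Theory.
Local Open Scope ring_scope.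

(* For f outside S0, f lies in a basis of maximum w'-weight iff f is not spanned
   by {x | w' f < w' x}; among the weights w' at distance d from w, the best for
   f raises w f by d and lowers all other weights by d.  Hence the optimum is
   the least (w e - w f) / 2 with w f <= w e such that f is not spanned by
   {x | w e < w x}.  This is tested for all pairs (e, f), without a binary
   search: a greedy scan in any order yields a maximal independent subset I of
   {x | w e < w x}, and f is unspanned iff f |: I is independent.
   If no element of weight w e were in S0, then by minimality all of them would
   be spanned by {x | w e < w x}, and the next smaller weight could replace w e;
   this gives the half-difference form with e in S0. *)

(** * Independent sets, bases and spanning in a matroid *)

Section MatroidLemmas.
Variables (S : finType) (M : matroid S).
Implicit Types (I J K X Y B : {set S}) (f x y : S).

(** Repeated exchange: each added element comes from [K], so the result stays inside [J :|: K]. *)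
Lemma indep_extend J K : indep M J -> indep M K -> (#|J| <= #|K|)%N ->
  exists J', [/\ J \subset J', J' \subset J :|: K, indep M J' & #|J'| = #|K|].
Proof.
move=> iJ iK; have [m] := ubnP (#|K| - #|J|)%N.
elim: m J iJ => // m IH J iJ lt_m; rewrite leq_eqVlt => /orP[/eqP eqJK|ltJK].
  by exists J; split=> //; apply: subsetUl.
have [y /setDP[yK yJ] iyJ] := indep_exchange iJ iK ltJK.
have cJ : #|y |: J| = #|J|.+1 by rewrite cardsU1 yJ.
have [||J' [sJ sJ' iJ' cJ']] := IH _ iyJ; rewrite ?cJ //.
  by rewrite subnS; case: (#|K| - #|J|)%N lt_m (subn_gt0 #|J| #|K|) => //= k; rewrite ltJK.
exists J'; split=> //; first exact: subset_trans (subsetUr _ _) sJ.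
by apply: subset_trans sJ' _; rewrite -setUA subUset sub1set !inE yK orbT subxx.
Qed.

Lemma basisP B : reflect (indep M B /\ forall J, indep M J -> (#|J| <= #|B|)%N)
  (basis M B).
Proof.
apply: (iffP maxsetP) => -[iB maxB]; split=> // J iJ.
  rewrite leqNgt; apply/negP => ltBJ.
  have [y /setDP[_ yB] iyB] := indep_exchange iB iJ ltBJ.
  by move: yB; rewrite -(maxB _ iyB (subsetUr _ _)) setU11.
by move=> sBJ; apply/esym/eqP; rewrite eqEcard sBJ maxB.
Qed.

(* [f] is not in the closure of [X], when [f] is not in [X]. *)
Definition unspanned X f := forall J, J \subset X -> indep M J -> indep M (f |: J).

Lemma unspannedS X Y f : X \subset Y -> unspanned Y f -> unspanned X f.
Proof. by move=> sXY uY J sJ; apply: uY; apply: subset_trans sXY. Qed.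

Definition maxindep X I := [/\ I \subset X, indep M I &
  forall x, x \in X -> x \notin I -> ~~ indep M (x |: I)].

(** By exchange, [I] has maximum size among the independent subsets of [X]. Growing [J] inside
    [J :|: (f |: I)] to size [#|I| + 1] must therefore pick up [f]. One oracle call thus decides
    [unspanned]. *)
Lemma maxindep_unspanned X I f : maxindep X I -> f \notin X ->
  unspanned X f <-> indep M (f |: I).
Proof.
move=> [sI iI maxI] fX; split=> [uf|ifI J sJ iJ]; first exact: uf.
have fI : f \notin I by apply: contra fX; apply: (subsetP sI).
have cI : #|f |: I| = #|I|.+1 by rewrite cardsU1 fI.
have leX K : K \subset X -> indep M K -> (#|K| <= #|I|)%N.
  move=> sK iK; rewrite leqNgt; apply/negP => /(indep_exchange iI iK)[y].
  by move=> /setDP[yK yI] iy; have := maxI _ (subsetP sK _ yK) yI; rewrite iy.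
have [|J' [sJJ' sJ' iJ' cJ']] := indep_extend iJ ifI.
  by rewrite cI; apply: leqW; apply: leX.
have [fJ'|fJ'] := boolP (f \in J').
  by apply: indep_sub iJ'; rewrite subUset sub1set fJ'.
have /leX : J' \subset X.
  apply/subsetP => x xJ'; move: (subsetP sJ' _ xJ'); rewrite !inE.
  case/or3P=> [/(subsetP sJ)//|/eqP xf|/(subsetP sI)//].
  by rewrite xf in xJ'; rewrite xJ' in fJ'.
by rewrite cJ' cI ltnn => /(_ iJ').
Qed.

Lemma maxindep0 : maxindep set0 set0.
Proof. by split=> [||x]; rewrite ?sub0set ?indep0 ?inE. Qed.

(** The greedy step: an element rejected earlier stays rejected because [I] only grows. *)
Lemma maxindepU1 X I x : maxindep X I ->
  maxindep (x |: X) (if indep M (x |: I) then x |: I else I).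
Proof.
move=> [sI iI maxI]; case: ifPn => ixI; split=> //.
- exact: setUS.
- move=> y; rewrite !inE negb_or => /predU1P[->|yX] /andP[yx yI].
    by rewrite eqxx in yx.
  by apply: contra (maxI _ yX yI); apply: indep_sub; apply/setUS/subsetUr.
- exact: subset_trans sI (subsetUr _ _).
by move=> y /setU1P[->|yX] yI //; apply: maxI.
Qed.

Lemma maxindep_exists X : exists I, maxindep X I.
Proof.
have [m] := ubnP #|X|; elim: m X => // m IH X.
have [->|[x xX] le_m] := set_0Vmem X; first by exists set0; apply: maxindep0.
have [|I mI] := IH (X :\ x); first by rewrite (cardsD1 x X) xX in le_m.
by rewrite -(setD1K xX); eexists; apply: maxindepU1 mI.
Qed.

(** A maximal independent subset of [X] is also maximal in [X :|: Y], since [X] spans all of [Y];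
    the same independence test then settles [f] for both sets. *)
Lemma unspannedU X Y f : f \notin X :|: Y -> unspanned X f ->
  (forall y, y \in Y -> y \in X \/ ~ unspanned X y) -> unspanned (X :|: Y) f.
Proof.
move=> fXY uf nY; have [I mI] := maxindep_exists X.
have [fX fY] : f \notin X /\ f \notin Y by move: fXY; rewrite inE negb_or => /andP.
have mXY : maxindep (X :|: Y) I.
  have [sI iI maxI] := mI; split=> //; first exact: subset_trans sI (subsetUl _ _).
  move=> x /setUP[|xY] xI; first by move/maxI; apply.
  have [xX|xX] := boolP (x \in X); first exact: maxI.
  case: (nY x xY) => [|nu]; first by rewrite (negPf xX).
  by apply/negP => ixI; apply: nu; apply/(maxindep_unspanned mI).
by apply/(maxindep_unspanned mXY) => //; apply/(maxindep_unspanned mI).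
Qed.

(** * Elements of maximum weight bases *)

Section Weighted.
Variables (R : realFieldType) (w : S -> R).

Lemma weight_swap B f x : f \in B -> x \notin B ->
  weight w (x |: (B :\ f)) = weight w B - w f + w x.
Proof.
move=> fB xB; rewrite /weight big_setU1 /=; last by rewrite !inE (negPf xB) andbF.
by rewrite [\sum_(s in B) _](big_setD1 f) //=; lra.
Qed.

(** Extend [J] by elements of [B] to the size of [B]. If the result avoids [f], exchanging [f] in
    [B] for one of its elements brings in some [x] of [J], heavier than [f], against the maximality
    of [B]. *)
Lemma max_weight_unspanned B f : max_weight_basis M w B -> f \in B ->
  unspanned [set x | w f < w x] f.
Proof.
move=> [bB maxB] fB J sJ iJ; have /basisP[iB cB] := bB.
have [J' [sJJ' sJ' iJ' cJ']] := indep_extend iJ iB (cB _ iJ).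
have [fJ'|fJ'] := boolP (f \in J').
  by apply: indep_sub iJ'; rewrite subUset sub1set fJ'.
have iBf : indep M (B :\ f) by apply: indep_sub iB; apply: subsetDl.
have [|x /setDP[xJ' xBf] ix] := indep_exchange iBf iJ'.
  by rewrite cJ' (cardsD1 f B) fB.
have xf : x != f by apply: contraNneq fJ' => <-.
have xB : x \notin B by move: xBf; rewrite !inE xf.
have xJ : x \in J by have := subsetP sJ' _ xJ'; rewrite inE (negPf xB) orbF.
have : basis M (x |: (B :\ f)).
  by apply/basisP; split=> // K /cB; rewrite cardsU1 xBf (cardsD1 f B) fB.
move=> /maxB; rewrite weight_swap //.
by have := subsetP sJ _ xJ; rewrite inE => h h'; clear -h h'; lra.
Qed.

Lemma max_weight_basis_exists : exists B, max_weight_basis M w B.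
Proof.
have [B0 bB0 _] := maxset_exists (indep0 M).
case: (Order.TotalTheory.arg_maxP (fun B => weight w B) (bB0 : basis M B0)) => B bB maxB.
by exists B; split.
Qed.

(** In a maximum weight basis [B] avoiding [f], keep the elements heavier than [f], add [f] and
    complete from [B]. This replaces a single [y] of [B] by [f], and [y] is no heavier than [f], so
    the weight does not drop. *)
Lemma unspanned_max_weight f : unspanned [set x | w f < w x] f ->
  exists2 B, max_weight_basis M w B & f \in B.
Proof.
move=> uf; have [B [bB maxB]] := max_weight_basis_exists.
have [fB|fB] := boolP (f \in B); first by exists B.
have /basisP[iB cB] := bB.
set J := [set x in B | w f < w x].
have iJ : indep M J by apply: indep_sub iB; apply/subsetP => x; rewrite inE => /andP[].
have ifJ : indep M (f |: J).
  by apply: uf => //; apply/subsetP => x; rewrite !inE => /andP[].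
have [K [sfJ sK iK cK]] := indep_extend ifJ iB (cB _ ifJ).
have fK : f \in K by apply: (subsetP sfJ); rewrite setU11.
have sKB : K :\ f \subset B.
  apply/subsetP => x; rewrite !inE => /andP[xf /(subsetP sK)].
  by rewrite !inE (negPf xf) /= => /orP[/andP[]|].
have cKB : #|B| = #|K :\ f|.+1 by rewrite -cK (cardsD1 f K) fK.
have [y yB yK] : exists2 y, y \in B & y \notin K :\ f.
  apply/subsetPn; apply/negP => /subset_leq_card.
  by rewrite cKB ltnn.
have yf : y != f by apply: contraNneq fB => <-.
have eB : B = y |: (K :\ f).
  by apply/esym/eqP; rewrite eqEcard subUset sub1set yB sKB cardsU1 yK cKB /=.
have wyf : w y <= w f.
  rewrite leNgt; apply: contra yK => wfy; rewrite !inE yf.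
  by apply: (subsetP sfJ); rewrite !inE yB wfy orbT.
have bK : basis M K by apply/basisP; split=> // L /cB; rewrite cK.
exists K => //; split=> // L /maxB /le_trans; apply.
rewrite [in X in X <= _]eB weight_swap //; first by clear -wyf; lra.
by move: yK; rewrite !inE yf.
Qed.

End Weighted.
End MatroidLemmas.

(** * Reduction of the problem to pairs of elements *)

Section Optimality.
Variables (R : realFieldType) (S : finType) (M : matroid S) (S0 : {set S}).
Variable w : S -> R.
Implicit Types (e f s x : S).

(* [f] can be put in a maximum weight basis by changing every weight by
   [(w e - w f) / 2]. *)
Definition candidate e f :=
  [/\ f \notin S0, w f <= w e & unspanned M [set x | w e < w x] f].

Definition least_candidate e f := candidate e f /\
  forall e' f', candidate e' f' -> w e - w f <= w e' - w f'.

Lemma dist_infty_const (w' : S -> R) d s :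
  (forall x, `|w x - w' x| = d) -> dist_infty w w' = d.
Proof.
move=> dw; apply/eqP; rewrite eq_le; apply/andP; split.
  by apply: bigmax_le => [|x _]; rewrite ?dw // -(dw s) normr_ge0.
by rewrite -(dw s); apply: (le_bigmax _ (fun x => `|w x - w' x|)).
Qed.

(** For [e] of maximum weight the set [[set x | w e < w x]] is empty, so any basis element outside
    [S0] can serve as [f]. *)
Lemma candidate_exists : (exists2 B, basis M B & ~~ (B \subset S0)) ->
  exists e f, candidate e f.
Proof.
move=> [B /basisP[iB _] /subsetPn[f fB fS0]].
have [e _ maxe] := Order.TotalTheory.arg_maxP w (isT : xpredT f).
have {}maxe x : w x <= w e by apply: maxe.
exists e, f; split=> //.
move=> J sJ _; apply: indep_sub iB; apply/subsetP => x /setU1P[->//|xJ].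
by have := subsetP sJ _ xJ; rewrite inE ltNge maxe.
Qed.

Lemma feasible_candidate (w' : S -> R) : feasible M S0 w' ->
  exists e f, candidate e f /\ (w e - w f) / 2 <= dist_infty w w'.
Proof.
move=> [B maxB /subsetPn[f fB fS0]]; set d := dist_infty w w'.
have ub x : w x - d <= w' x <= w x + d.
  have : `|w x - w' x| <= d by apply: (le_bigmax _ (fun s => `|w s - w' s|)).
  by rewrite ler_distl; lra.
have d0 : 0 <= d by apply: bigmax_ge_id.
have wf : w f <= w f + 2 * d by lra.
(* With [e] heaviest among the weights up to [w f + 2 * d], whatever is heavier than [e] exceeds [f]
   by more than [2 * d] under [w], hence is still heavier than [f] under [w']. *)
have [e /= we maxe] :=
  Order.TotalTheory.arg_maxP w (wf : [pred x | w x <= w f + 2 * d] f).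
have {}maxe x : w x <= w f + 2 * d -> w x <= w e by move/(maxe x).
exists e, f; split; last by lra.
split=> //; first exact: maxe.
apply: unspannedS (max_weight_unspanned maxB fB).
apply/subsetP => x; rewrite !inE => wex.
have : w f + 2 * d < w x.
  by rewrite ltNge; apply/negP => /maxe; rewrite leNgt wex.
by have := ub x; have := ub f; lra.
Qed.

(** Under [w'] an element beats [f] only if [w x] exceeds [w f + 2 * d], which is [w e]. *)
Lemma candidate_feasible (w' : S -> R) e f : candidate e f ->
  let d := (w e - w f) / 2 in
  (forall x, w' x = if x == f then w x + d else w x - d) -> feasible M S0 w'.
Proof.
move=> [fS0 wfe uf] d w'E.
have [|B maxB fB] := @unspanned_max_weight _ M R w' f.
  apply: unspannedS uf; apply/subsetP => x; rewrite !inE !w'E eqxx /d.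
  by case: eqP => [->|_]; lra.
by exists B => //; apply/subsetPn; exists f.
Qed.

Lemma least_candidate_mem e f : least_candidate e f ->
  w e = w f \/ exists2 e', e' \in S0 & w e' = w e.
Proof.
move=> [[fS0 wfe uf] minef].
have [/exists_inP[e' e'S0 /eqP]|noS0] := boolP [exists e' in S0, w e' == w e].
  by right; exists e'.
left; apply/eqP; rewrite eq_le wfe andbT leNgt; apply/negP => ltfe.
(* [e2] carries the next smaller weight, so elements heavier than [e2] weigh at least [w e]. *)
have [e2 /= lte2 maxe2] :=
  Order.TotalTheory.arg_maxP w (ltfe : [pred x | w x < w e] f).
have {}maxe2 x : w x < w e -> w x <= w e2 by move/(maxe2 x).
suff : candidate e2 f by move/minef; lra.
split=> //; first exact: maxe2.
have : unspanned M ([set x | w e < w x] :|: [set x | w x == w e]) f.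
  apply: unspannedU => // [|y]; first by rewrite !inE; lra.
  rewrite inE => /eqP wy; right => uy.
  have yS0 : y \notin S0.
    by apply: contra noS0 => yS0; apply/exists_inP; exists y => //; apply/eqP.
  (* Paired with itself, [y] has difference 0, below the least difference [w e - w f], which is
     positive here. *)
  have : candidate y y by split; rewrite ?wy.
  by move/minef; lra.
apply: unspannedS; apply/subsetP => x; rewrite !inE => lt2x.
by rewrite orbC eq_sym -le_eqVlt leNgt; apply/negP => /maxe2; lra.
Qed.

Lemma least_candidate_optimal (w' : S -> R) e f : least_candidate e f ->
  let d := (w e - w f) / 2 in
  (forall x, w' x = if x == f then w x + d else w x - d) ->
  optimal M S0 w w' /\ dist_infty w w' = d.
Proof.
move=> ef d w'E; have [cef minef] := ef; have [fS0 wfe uf] := cef.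
have dE : dist_infty w w' = d.
  have d0 : 0 <= d by rewrite /d; lra.
  apply: (dist_infty_const f) => x; rewrite w'E; case: ifP => _.
    by rewrite opprD addNKr normrN ger0_norm.
  by rewrite opprB addrC subrK ger0_norm.
split=> //; split; first exact: candidate_feasible w'E.
move=> w'' /feasible_candidate[e' [f' [cef' le]]].
by rewrite dE; apply: le_trans le; have := minef _ _ cef'; rewrite /d; lra.
Qed.

End Optimality.

(* Every loop of the program below runs [#|S|] times. *)
Fixpoint cost (c : cmd) : {poly nat} :=
  match c with
  | Do _ => 1
  | Seq c1 c2 => cost c1 + cost c2
  | If _ c1 c2 => cost c1 + cost c2 + 1
  | While _ c => 'X * (cost c + 1) + 1
  end.

(** * Total correctness with a running time bound *)

Section WeakestPrecondition.
Variables (R : realFieldType) (S : finType) (oracle : pred {set S}).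
Implicit Types (st : state R) (P Q : state R -> Prop).

Definition wp c Q st := exists st' t,
  [/\ exec oracle c st st' t, (t <= (cost c).[#|S|])%N & Q st'].

Lemma wp_do i Q st : Q (eval_instr oracle i st) -> wp (Do i) Q st.
Proof. by exists (eval_instr oracle i st), 1%N; split; rewrite ?hornerE //; constructor. Qed.

Lemma wp_seq c1 c2 Q st : wp c1 (wp c2 Q) st -> wp (Seq c1 c2) Q st.
Proof.
move=> [st1 [t1 [e1 l1 [st2 [t2 [e2 l2 Qst2]]]]]].
exists st2, (t1 + t2)%N; split=> //; first exact: exec_seq e1 e2.
by rewrite /= hornerD leq_add.
Qed.

Lemma wp_if b c1 c2 Q st :
  wp (if eval_test b st then c1 else c2) Q st -> wp (If b c1 c2) Q st.
Proof.
move=> [st' [t [e l Qst']]]; exists st', t.+1; split=> //; first exact: exec_if.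
have -> : (cost (If b c1 c2)).[#|S|] = ((cost c1).[#|S|] + (cost c2).[#|S|]).+1.
  by rewrite /= !hornerE; apply: addn1.
by rewrite ltnS; apply: leq_trans l _; case: ifP; rewrite ?leq_addr ?leq_addl.
Qed.

(** The index of [Inv] counts completed iterations; tying the test to it forces exactly [#|S|]
    rounds, which justifies [cost] on loops. *)
Lemma wp_while b c (Inv : nat -> state R -> Prop) st :
  (forall i st', Inv i st' -> eval_test b st' = (i < #|S|)%N) ->
  (forall i st', (i < #|S|)%N -> Inv i st' -> wp c (Inv i.+1) st') ->
  Inv 0%N st -> wp (While b c) (Inv #|S|) st.
Proof.
move=> test body Inv0.
suff loop k : forall i st', (i + k)%N = #|S| -> Inv i st' ->
    exists st'' t, [/\ exec oracle (While b c) st' st'' t,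
      (t <= k * ((cost c).[#|S|] + 1) + 1)%N & Inv #|S| st''].
  have [//|st'' [t [e l I]]] := loop #|S| 0%N st _ Inv0.
  by exists st'', t; split=> //; rewrite /= !hornerE.
elim: k => [|k IH] i st' eik Invi.
  exists st', 1%N; move: Invi; rewrite -eik addn0 => Invi; split=> //.
  by apply: exec_while_end; rewrite (test _ _ Invi) -eik addn0 ltnn.
have lt_i : (i < #|S|)%N by rewrite -eik -addSnnS leq_addr.
have [st1 [t1 [e1 l1 Inv1]]] := body _ _ lt_i Invi.
have [|st2 [t2 [e2 l2 Inv2]]] := IH i.+1 st1 _ Inv1; first by rewrite addSnnS.
exists st2, (t1 + t2).+1; split=> //.
  by apply: exec_while_step e1 e2; rewrite (test _ _ Invi).
by rewrite mulSn; lia.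
Qed.

Lemma wp_mono c P Q st : (forall st', P st' -> Q st') -> wp c P st -> wp c Q st.
Proof. by move=> PQ [st' [t [? ? /PQ ?]]]; exists st', t. Qed.

End WeakestPrecondition.

(** * The program *)

Section Program.
Local Open Scope nat_scope.

(* Registers: 0 holds #|S|, 1 and 2 the constants 1 and 0, 3 and 4 the loop
   indices e and f, and 5 the best f so far, or #|S| if there is none.  The best
   value of w e - w f is in cell 0 of the real array 2; the boolean array 1
   holds the greedy independent subset of {x | w e < w x}. *)
Definition skip := Do (NConst 6 0).
Definition advance := Do (NAdd 4 4 1).
Definition scan c := Seq (Do (NConst 4 0)) (While (NLt 4 0) c).
Definition clear_step := Seq (Do (BConst (1, 4) false)) advance.
(** The query writes its answer into the bit just set, so the element stays exactly when the
    enlarged set is independent. *)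
Definition greedy_step :=
  Seq (If (RLe (0, 4) (0, 3)) skip
        (Seq (Do (BConst (1, 4) true)) (Do (Query (1, 4) 1)))) advance.
(** Adding register 2, which holds 0, copies register 4 into register 5. *)
Definition record := Seq (Do (RMov (2, 2) (3, 2))) (Do (NAdd 5 4 2)).
Definition compare :=
  Seq (Do (ROp Defs.Sub (3, 2) (0, 3) (0, 4)))
    (If (NLt 5 0) (If (RLe (2, 2) (3, 2)) skip record) record).
(** The bit of [f] holds first the trial, then the answer; clearing it restores the greedy set for
    the next [f]. *)
Definition probe :=
  Seq (Do (BConst (1, 4) true)) (Seq (Do (Query (1, 4) 1))
    (Seq (If (BTest (1, 4)) compare skip) (Do (BConst (1, 4) false)))).
Definition probe_step :=
  Seq (If (BTest (0, 4)) skip (If (RLe (0, 4) (0, 3)) probe skip)) advance.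
Definition outer_step :=
  Seq (scan clear_step)
    (Seq (scan greedy_step) (Seq (scan probe_step) (Do (NAdd 3 3 1)))).
Definition search :=
  Seq (Do (NConst 1 1)) (Seq (Do (NConst 2 0)) (Seq (Do (NAdd 5 0 2))
    (Seq (Do (NConst 3 0)) (While (NLt 3 0) outer_step)))).
Definition write_step := Seq (Do (ROp Defs.Sub (1, 4) (0, 4) (2, 2))) advance.
Definition write :=
  Seq (Do (RConst (3, 2) 2)) (Seq (Do (ROp Defs.Div (2, 2) (2, 2) (3, 2)))
    (Seq (scan write_step) (Do (ROp Defs.Add (1, 5) (0, 5) (2, 2))))).
Definition program := Seq search write.

End Program.

(** * Bookkeeping of the examined pairs *)

Section Correctness.
Variables (R : realFieldType) (S : finType) (M : matroid S) (S0 : {set S}).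
Variable w : S -> R.
Implicit Types (e f s x : S) (st : state R) (D : S -> S -> Prop).

Local Notation wp := (wp (indep M)).
Local Notation candidate := (candidate M S0 w).

Lemma enum_rank_onto i : (i < #|S|)%N -> exists s : S, i = enum_rank s.
Proof. by move=> lti; exists (enum_val (Ordinal lti)); rewrite enum_valK. Qed.

Lemma enum_rank_ltS s x :
  (enum_rank x < (enum_rank s).+1)%N = (x == s) || (enum_rank x < enum_rank s)%N.
Proof. by rewrite ltnS leq_eqVlt (inj_eq val_inj) (inj_eq enum_rank_inj). Qed.

Lemma decode_upd (b : nat -> bool) s v :
  decode S (upd b (enum_rank s) v) = if v then s |: decode S b else decode S b :\ s.
Proof.
apply/setP => x; rewrite inE /upd (inj_eq val_inj) (inj_eq enum_rank_inj).
by case: v; rewrite !inE; case: eqP.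
Qed.

Lemma upd_eq (T : Type) (h : nat -> T) i v : upd h i v i = v.
Proof. by rewrite /upd eqxx. Qed.

Lemma wp_scan c (Inv : nat -> state R -> Prop) st :
  (forall i st', Inv i st' -> reg st' 0 = #|S| /\ reg st' 4 = i) ->
  (forall s st', Inv (enum_rank s) st' -> wp c (Inv (enum_rank s).+1) st') ->
  Inv 0%N (set_reg st 4 0) -> wp (scan c) (Inv #|S|) st.
Proof.
move=> Ireg body I0; apply/wp_seq/wp_do; apply: wp_while => //.
  by move=> i st' /Ireg[/= -> ->].
by move=> i st' /enum_rank_onto[s ->]; apply: body.
Qed.

Definition ready st :=
  [/\ encodes_input S0 w st, reg st 1 = 1%N & reg st 2 = 0%N].

(* The candidates in [D] have been examined. *)
Definition incumbent D (r : nat) (v : R) :=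
  (r = #|S| /\ forall e f, D e f -> ~ candidate e f) \/
  exists e f, [/\ candidate e f, r = enum_rank f, v = w e - w f &
    forall e' f', D e' f' -> candidate e' f' -> v <= w e' - w f'].

Definition searching e D st :=
  [/\ ready st, reg st 3 = enum_rank e & incumbent D (reg st 5) (rarr st 2 0)].

Lemma incumbentS D D' r v : (forall e f, D' e f -> D e f) ->
  incumbent D r v -> incumbent D' r v.
Proof.
move=> sD [[-> nD]|[e [f [cef -> -> leD]]]]; [left|right].
  by split=> // e f /sD; apply: nD.
by exists e, f; split=> // e' f' /sD; apply: leD.
Qed.

Section Examine.
Variables (D D' : S -> S -> Prop) (e f : S) (r : nat) (v : R).
Hypothesis DD' : forall e' f', D' e' f' -> D e' f' \/ e' = e /\ f' = f.
Hypothesis inc : incumbent D r v.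

Lemma incumbent_skip : ~ candidate e f -> incumbent D' r v.
Proof.
move=> ncef; case: inc => [[-> nD]|[e1 [f1 [c1 -> -> leD]]]]; [left|right].
  by split=> // e' f' /DD'[/nD//|[-> ->]].
by exists e1, f1; split=> // e' f' /DD'[/leD//|[-> ->] /ncef].
Qed.

Lemma incumbent_keep : (r < #|S|)%N -> v <= w e - w f -> incumbent D' r v.
Proof.
move=> ltr lev; case: inc => [[rE]|[e1 [f1 [c1 -> vE leD]]]].
  by rewrite rE ltnn in ltr.
by right; exists e1, f1; split=> // e' f' /DD'[/leD//|[-> ->] _].
Qed.

(** [r < #|S|] tells whether an incumbent exists, since ranks lie below [#|S|]. If there is none, no
    earlier pair is a candidate; otherwise the new difference is below [v], which bounds all earlier
    ones. *)
Lemma incumbent_replace : candidate e f -> ~~ ((r < #|S|)%N && (v <= w e - w f)) ->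
  incumbent D' (enum_rank f) (w e - w f).
Proof.
move=> cef worse; right; exists e, f; split=> // e' f' /DD'[De'f' c'|[-> ->] _ //].
case: inc => [[_ nD]|[e1 [f1 [c1 rE vE leD]]]]; first by case: (nD _ _ De'f').
apply: le_trans (leD _ _ De'f' c'); move: worse.
by rewrite rE ltn_ord /= -ltNge => /ltW.
Qed.

End Examine.

(** * Correctness of the nested loops *)

Lemma wp_clear e D st : searching e D st ->
  wp (scan clear_step)
    (fun st' => searching e D st' /\ decode S (barr st' 1) = set0) st.
Proof.
move=> sea; pose Inv i st' := [/\ searching e D st', reg st' 4 = i &
  forall x, x \in decode S (barr st' 1) -> (i <= enum_rank x)%N].
apply: (@wp_mono _ _ _ _ (Inv #|S|)) => [st' [sea' _ dec]|].
  split=> //; apply/setP => x; rewrite in_set0; apply/negP => /dec.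
  by rewrite leqNgt ltn_ord.
apply: wp_scan => [i st' [[[[r0 _ _] _ _] _ _] r4 _]|s st' [sea' r4 dec]|//].
  by split.
have [[_ r1 _] _ _] := sea'.
apply/wp_seq/wp_do/wp_do; split=> /=; [exact: sea'|by rewrite /upd /= r4 r1 addn1|].
move=> x; rewrite r4 /upd2 upd_eq decode_upd => /setD1P[xs /dec].
by rewrite leq_eqVlt (inj_eq val_inj) (inj_eq enum_rank_inj) eq_sym (negPf xs).
Qed.

Lemma wp_greedy e D st : searching e D st -> decode S (barr st 1) = set0 ->
  wp (scan greedy_step) (fun st' => searching e D st' /\
    maxindep M [set x | w e < w x] (decode S (barr st' 1))) st.
Proof.
(* [X i] collects the elements heavier than [e] among the first [i] in the enumeration. *)
move=> sea dec0; pose X i := [set x | (w e < w x) && (enum_rank x < i)%N].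
pose Inv i st' := [/\ searching e D st', reg st' 4 = i &
  maxindep M (X i) (decode S (barr st' 1))].
apply: (@wp_mono _ _ _ _ (Inv #|S|)) => [st' [sea' _ dec]|].
  split=> //; congr (maxindep M _ _): dec; apply/setP => x.
  by rewrite !inE ltn_ord andbT.
apply: wp_scan => [i st' [[[[r0 _ _] _ _] _ _] r4 _]|s st' [sea' r4 dec]|].
- by split.
- have [[[r0 a0 b0] r1 _] r3 _] := sea'.
  have XS : X (enum_rank s).+1 = if w e < w s then s |: X (enum_rank s) else X (enum_rank s).
    apply/setP => x; rewrite inE enum_rank_ltS.
    by case: ifP => wes; rewrite !inE; case: eqP => [->|]; rewrite ?wes ?andbT ?ltnn ?andbF.
  apply/wp_seq/wp_if; rewrite /= /rget /= r3 r4 !a0 leNgt if_neg.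
  case: ifP XS => wes XS.
    apply/wp_seq/wp_do/wp_do/wp_do; split; [exact: sea'|by rewrite /= /upd /= r4 r1 addn1|].
    (* A negative answer must restore the old set; removing [s] does so because [s] was outside
       it. *)
    have sX : s \notin decode S (barr st' 1).
      by case: dec => /subsetP sX _ _; apply/negP => /sX; rewrite inE ltnn andbF.
    rewrite /= r4 /upd2 !upd_eq XS !decode_upd setU1K //.
    by rewrite setUA setUid; apply: maxindepU1.
  apply/wp_do/wp_do; split; [exact: sea'|by rewrite /= /upd /= r4 r1 addn1|].
  by rewrite XS.
split=> //; rewrite /= dec0; congr (maxindep M _ _): (maxindep0 M).
by apply/esym/setP => x; rewrite !inE ltn0 andbF.
Qed.

Section Probe.
Variables (D D' : S -> S -> Prop) (e f : S).
Hypothesis DD' : forall e' f', D' e' f' -> D e' f' \/ e' = e /\ f' = f.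

Lemma wp_compare st : searching e D st -> reg st 4 = enum_rank f ->
  candidate e f -> wp compare (fun st' => [/\ searching e D' st',
    reg st' 4 = enum_rank f & barr st' = barr st]) st.
Proof.
move=> [rdy r3 inc] r4 cef; have [[r0 a0 b0] r1 r2] := rdy.
have replace : ~~ ((reg st 5 < #|S|)%N && (rarr st 2 0%N <= w e - w f)) ->
    incumbent D' (enum_rank f + 0)%N (w e - w f).
  by move=> worse; rewrite addn0; apply: incumbent_replace inc cef worse.
apply/wp_seq/wp_do/wp_if; rewrite /= /rget /= r0 r3 r4 !a0.
case: ifP replace => lt5 replace.
  apply/wp_if; rewrite /= /rget /= /upd2 /upd /= !r2 /=.
  case: ifP replace => lev replace.
    apply/wp_do; split=> //; split; first exact: rdy; first exact: r3.
    exact: incumbent_keep inc lt5 lev.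
  apply/wp_seq/wp_do/wp_do; split=> //; split; first exact: rdy; first exact: r3.
  by rewrite /= /rget /= /upd2 /upd /= !r2 /= r4; apply: replace.
apply/wp_seq/wp_do/wp_do; split=> //; split; first exact: rdy; first exact: r3.
by rewrite /= /rget /= /upd2 /upd /= !r2 /= r4; apply: replace.
Qed.

Lemma wp_probe st : searching e D st -> reg st 4 = enum_rank f ->
  maxindep M [set x | w e < w x] (decode S (barr st 1)) ->
  f \notin S0 -> w f <= w e ->
  wp probe (fun st' => [/\ searching e D' st', reg st' 4 = enum_rank f &
    decode S (barr st' 1) = decode S (barr st 1)]) st.
Proof.
move=> sea r4 max fS0 wfe; have [_ _ inc] := sea.
have fX : f \notin [set x | w e < w x] by rewrite inE -leNgt.
have fI : f \notin decode S (barr st 1).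
  by case: max => /subsetP sX _ _; apply: contra fX => /sX.
have cefE : candidate e f <-> indep M (f |: decode S (barr st 1)).
  rewrite -(maxindep_unspanned max fX); split=> [[]//|uf]; by split.
apply/wp_seq/wp_do/wp_seq/wp_do/wp_seq/wp_if.
set st1 := eval_instr _ _ _.
have sea1 : searching e D st1 by exact: sea.
have r41 : reg st1 4 = enum_rank f by [].
have bE : bget st1 (1%N, 4%N) = indep M (f |: decode S (barr st 1)).
  by rewrite /bget /= r4 /upd2 !upd_eq decode_upd.
have dec1 : decode S (barr st1 1) :\ f = decode S (barr st 1).
  rewrite /= r4 /upd2 !upd_eq !decode_upd.
  case: ifP => _; rewrite ?setUA ?setUid setU1K //.
  by apply/setDidPl; rewrite disjoint_sym disjoints1.
have clr st' : searching e D' st' -> reg st' 4 = enum_rank f -> barr st' = barr st1 ->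
    wp (Do (BConst (1%N, 4%N) false)) (fun st' => [/\ searching e D' st',
      reg st' 4 = enum_rank f & decode S (barr st' 1) = decode S (barr st 1)]) st'.
  move=> sea' r4' bar'; apply: wp_do; split=> //.
  by rewrite /= r4' /upd2 upd_eq decode_upd bar'.
rewrite [eval_test _ _]bE; case: ifP cefE => [_ [_ /(_ isT) cef]|_ [ncef _]].
  by apply: wp_mono (wp_compare sea1 r41 cef) => st' [*]; apply: clr.
apply/wp_do/clr => //; split; [by case: sea1|by case: sea1|].
by apply: (incumbent_skip DD' inc) => /ncef.
Qed.

End Probe.

Lemma wp_probes e D D' st : searching e D st ->
  (forall e' f', D' e' f' -> D e' f' \/ e' = e) ->
  maxindep M [set x | w e < w x] (decode S (barr st 1)) ->
  wp (scan probe_step) (searching e D') st.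
Proof.
move=> sea DD' max.
(* Besides [D], the pairs of [e] with the first [i] elements have been examined. *)
pose E i e' f' := D e' f' \/ e' = e /\ (enum_rank f' < i)%N.
pose Inv i st' := [/\ searching e (E i) st', reg st' 4 = i &
  maxindep M [set x | w e < w x] (decode S (barr st' 1))].
apply: (@wp_mono _ _ _ _ (Inv #|S|)) => [st' [[rdy r3 inc] _ _]|].
  split=> //; apply: incumbentS inc => e' f' /DD'[]; first by left.
  by right; rewrite ltn_ord.
apply: wp_scan => [i st' [[[[r0 _ _] _ _] _ _] r4 _]|f st' [sea' r4 max']|].
- by split.
- have [[[r0 a0 b0] r1 r2] r3 inc] := sea'.
  have EE e' f' : E (enum_rank f).+1 e' f' ->
      E (enum_rank f) e' f' \/ e' = e /\ f' = f.
    move=> [De|[-> ]]; first by left; left.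
    by rewrite enum_rank_ltS => /orP[/eqP->|]; [right|left; right].
  suff step : wp (If (BTest (0%N, 4%N)) skip (If (RLe (0%N, 4%N) (0%N, 3%N)) probe skip))
      (fun st' => [/\ searching e (E (enum_rank f).+1) st', reg st' 4 = enum_rank f &
      maxindep M [set x | w e < w x] (decode S (barr st' 1))]) st'.
    apply/wp_seq; apply: wp_mono step => st1 [sea1 r41 max1].
    apply: wp_do; split; [exact: sea1| |exact: max1].
    by case: sea1 => [[_ r11 _] _ _]; rewrite /= /upd /= r41 r11 addn1.
  have skipped : ~ candidate e f ->
      wp skip (fun st' => [/\ searching e (E (enum_rank f).+1) st',
        reg st' 4 = enum_rank f &
        maxindep M [set x | w e < w x] (decode S (barr st' 1))]) st'.
    move=> ncef; apply: wp_do; split=> //; split=> //.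
    exact: incumbent_skip EE inc ncef.
  apply/wp_if; rewrite /= /bget /= r4 b0; case: ifPn => [fS0|fS0].
    by apply: skipped => -[]; rewrite fS0.
  apply/wp_if; rewrite /= /rget /= r3 r4 !a0; case: ifPn => [wfe|nwfe].
    apply: wp_mono (wp_probe EE sea' r4 max' fS0 wfe) => st1 [sea1 r41 dec1].
    by rewrite dec1.
  by apply: skipped => -[_]; rewrite (negPf nwfe).
split=> //; have [rdy r3 inc] := sea; split=> //.
by apply: incumbentS inc => e' f' [|[]].
Qed.

Lemma wp_search st : encodes_input S0 w st ->
  wp search (fun st' => ready st' /\
    incumbent (fun _ _ => True) (reg st' 5) (rarr st' 2 0)) st.
Proof.
move=> inp; have [r0 a0 b0] := inp.
pose E i (e' f' : S) := (enum_rank e' < i)%N : Prop.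
pose Inv i st' := [/\ ready st', reg st' 3 = i &
  incumbent (E i) (reg st' 5) (rarr st' 2 0)].
do 4![apply/wp_seq/wp_do].
apply: (@wp_mono _ _ _ _ (Inv #|S|)) => [st' [rdy _ inc]|].
  by split=> //; apply: incumbentS inc => e' f' _; apply: ltn_ord.
apply: wp_while => [i st' [[[r0' _ _] _ _] r3 _]|i st'|].
- by rewrite /= r0' r3.
- move=> /enum_rank_onto[e ->] sea.
  apply/wp_seq/(wp_mono _ (wp_clear sea)) => st1 [sea1 dec1].
  apply/wp_seq/(wp_mono _ (wp_greedy sea1 dec1)) => st2 [sea2 max2].
  have EE e' f' : E (enum_rank e).+1 e' f' -> E (enum_rank e) e' f' \/ e' = e.
    by rewrite /E enum_rank_ltS => /orP[/eqP|]; [right|left].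
  apply/wp_seq/(wp_mono _ (wp_probes sea2 EE max2)) => st3 [rdy3 r33 inc3].
  apply: wp_do; split; [exact: rdy3| |exact: inc3].
  by case: rdy3 => _ r13 _; rewrite /= /upd /= r33 r13 addn1.
(* Initially no pair is examined and register 5 holds [#|S|], the mark for no incumbent. *)
split=> //; left; split=> //=.
by rewrite /upd /= r0 addn0.
Qed.

(** * Output and conclusion *)

Lemma wp_write f v st : ready st -> reg st 5 = enum_rank f -> rarr st 2 0%N = v ->
  wp write (fun st' => forall x, output st' x =
    if x == f then w x + v / 2 else w x - v / 2) st.
Proof.
move=> rdy r5 vE; have [[r0 a0 b0] r1 r2] := rdy.
apply/wp_seq/wp_do/wp_seq/wp_do/wp_seq.
set st1 := eval_instr _ _ _.
have v1 : rarr st1 2 0%N = v / 2.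
  by rewrite /st1 /= /rget /= /upd2 /upd /= !r2 /= vE.
pose Inv i st' := [/\ ready st', reg st' 4 = i,
  reg st' 5 = enum_rank f /\ rarr st' 2 0%N = v / 2 &
  forall x, (enum_rank x < i)%N -> rarr st' 1 (enum_rank x) = w x - v / 2].
apply: (@wp_mono _ _ _ _ (Inv #|S|)) => [st' [[[r0' a0' _] _ r2'] r4' [r5' v']] out|].
  (* The loop has lowered every weight; the last instruction overwrites the cell of [f] with the
     raised one. *)
  apply/wp_do => x; rewrite /output /= /rget /= r5' r2' a0' v' /upd2 upd_eq /upd.
  rewrite (inj_eq val_inj) (inj_eq enum_rank_inj).
  by case: eqP => [->//|_]; rewrite out ?ltn_ord.
apply: wp_scan => [i st' [[[r0' _ _] _ _] r4 _ _]|s st' [rdy' r4' [r5' v'] out]|//].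
  by split.
have [[r0' a0' _] r1' r2'] := rdy'.
apply/wp_seq/wp_do/wp_do; split; [exact: rdy'|by rewrite /= /upd /= r4' r1' addn1|by []|].
move=> x; rewrite enum_rank_ltS /= /rget /= r4' r2' a0' v' /upd2 upd_eq /upd.
rewrite (inj_eq val_inj) (inj_eq enum_rank_inj).
by case: eqP => [->//|_] /= /out.
Qed.

Lemma wp_program st : (exists2 B, basis M B & ~~ (B \subset S0)) ->
  encodes_input S0 w st ->
  wp program (fun st' => exists e f, least_candidate M S0 w e f /\
    forall x, output st' x =
      if x == f then w x + (w e - w f) / 2 else w x - (w e - w f) / 2) st.
Proof.
move=> /candidate_exists-/(_ _ w)[e0 [f0 c0]] inp.
apply/wp_seq/(wp_mono _ (wp_search inp)) => st1 [rdy1].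
(* An empty incumbent is excluded by the candidate [(e0, f0)]. *)
case=> [[_ /(_ e0 f0 I)]//|[e [f [cef r5 vE le]]]].
apply: wp_mono (wp_write rdy1 r5 vE) => st2 out; exists e, f; split=> //.
by split=> // e' f' cef'; rewrite -vE; apply: le.
Qed.

End Correctness.

Theorem theorem6p3 (R : realType) :
  exists (prog : cmd) (p : {poly nat}),
  forall (S : finType) (M : matroid S) (S0 : {set S}) (w : S -> R),
  (exists2 B, basis M B & ~~ (B \subset S0)) ->
  forall st : state R, encodes_input S0 w st ->
  exists (st' : state R) (t : nat),
    let w' := output st' in
    let d := dist_infty w w' in
    [/\ exec (indep M) prog st st' t,
        (t <= p.[#|S|])%N,
        optimal M S0 w w'
      & d = 0 \/
        exists e f : S, [/\ e \in S0, f \notin S0 &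
          d = (w e - w f) / 2 \/ d = - ((w e - w f) / 2)]].
Proof.
exists program, (cost program) => S M S0 w exB st inp.
have [st' [t [run le_t [e [f [ef out]]]]]] := wp_program exB inp.
have [opt dE] := least_candidate_optimal ef out.
exists st', t; split=> //; rewrite dE.
have [->|[e' e'S0 <-]] := least_candidate_mem ef; [left|right].
  by rewrite subrr mul0r.
by exists e', f; split=> //; [case: ef => -[] | left].
Qed.
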